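(* Consider the standard triple $(\mathrm{Sp}(4),\,2\,\mathrm{Sp}(2),\,4\,\mathrm{Sp}(1))$, and let $4\,\mathfrak{sp}(1)=\mathfrak{sp}(1)\oplus\mathfrak{sp}(1)\oplus\mathfrak{sp}(1)\oplus\mathfrak{sp}(1)\subset\mathfrak{sp}(4)$ be the Lie algebra of $4\,\mathrm{Sp}(1)$. Then there exists a pair $(\theta,\tau)$ of involutions of the Lie algebra $\mathfrak{sp}(4)$ such that $\theta\tau=\tau\theta$ and $$4\,\mathfrak{sp}(1)=\{x\in\mathfrak{sp}(4)\mid \theta(x)=x,\ \tau(x)=x\}.$$
   Context: $\mathrm{Sp}(n)$ is the compact symplectic group, i.e. the group of $n\times n$ quaternionic matrices $A$ with $A^*A=I$, and $\mathfrak{sp}(n)$ is its Lie algebra of quaternionic skew-Hermitian $n\times n$ matrices. The notation $2\,\mathrm{Sp}(2)$ means $\mathrm{Sp}(2)\times\mathrm{Sp}(2)$ and $4\,\mathrm{Sp}(1)$ means $\mathrm{Sp}(1)\times\mathrm{Sp}(1)\times\mathrm{Sp}(1)\times\mathrm{Sp}(1)$, embedded in $\mathrm{Sp}(4)$ block-diagonally, so that $4\,\mathrm{Sp}(1)\subset 2\,\mathrm{Sp}(2)\subset \mathrm{Sp}(4)$; thus $4\,\mathfrak{sp}(1)$ is the subalgebra of diagonal matrices in $\mathfrak{sp}(4)$. An involution of a Lie algebra is a Lie algebra automorphism of order $2$. Standard triple: $(G,K,H)$ where $G$ is a compact simple Lie group, $K$ a closed subgroup such that $G/K$ is a compact irreducible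 symmetric space, and $H$ a closed subgroup of $K$, with Lie algebras $\mathfrak g,\mathfrak k,\mathfrak h$ and negative Killing forms $B,B_{\mathfrak k},B_{\mathfrak h}$, and $B$-orthogonal decomposition $\mathfrak g=\mathfrak k\oplus\mathfrak p=\mathfrak h\oplus\mathfrak u\oplus\mathfrak p$, such that (1) $B_{\mathfrak k}=c_1B|_{\mathfrak k}$ and $B_{\mathfrak h}=c_2B|_{\mathfrak h}$ for some $c_1,c_2>0$; (2) for a $B$-orthonormal basis $\{h_i\}$ of $\mathfrak h$, $\sum_i \mathrm{ad}(h_i)^2|_{\mathfrak u}=-\lambda_u\,\mathrm{id}$ and $\sum_i \mathrm{ad}(h_i)^2|_{\mathfrak p}=-\lambda_p\,\mathrm{id}$ for some $\lambda_u,\lambda_p>0$; and (3) the standard homogeneous metric on $G/H$ induced by $B$ is Einstein. The triple $(\mathrm{Sp}(4),2\,\mathrm{Sp}(2),4\,\mathrm{Sp}(1))$ is a standard triple. *)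

(* Defs.v *)
From HB Require Import structures.
From mathcomp Require Import all_boot all_order all_algebra.
From mathcomp Require Import reals.
From mathcomp Require Import ring.

Set Implicit Arguments.
Unset Strict Implicit.
Unset Printing Implicit Defensive.

Import GRing.Theory.
Local Open Scope ring_scope.

(* [Quat a b c d] is the real quaternion a + b i + c j + d k. *)
Record quat (R : realType) := Quat { qre : R; qi : R; qj : R; qk : R }.

Section Quaternions.
Variable R : realType.
Implicit Types p q r : quat R.

Definition quat_to_prod q : R * R * R * R := (qre q, qi q, qj q, qk q).
Definition quat_of_prod (x : R * R * R * R) : quat R :=
  let: (a, b, c, d) := x in Quat a b c d.

Lemma quat_to_prodK : cancel quat_to_prod quat_of_prod.
Proof. by case. Qed.

HB.instance Definition _ := Choice.copy (quat R) (can_type quat_to_prodK).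

Definition addq p q :=
  Quat (qre p + qre q) (qi p + qi q) (qj p + qj q) (qk p + qk q).
Definition oppq p := Quat (- qre p) (- qi p) (- qj p) (- qk p).

Fact addqA : associative addq.
Proof. by move=> [????] [????] [????]; rewrite /addq /= !addrA. Qed.
Fact addqC : commutative addq.
Proof.
by move=> [a b c d] [a' b' c' d']; rewrite /addq /= (addrC a) (addrC b)
  (addrC c) (addrC d).
Qed.
Fact add0q : left_id (Quat 0 0 0 0) addq.
Proof. by move=> [????]; rewrite /addq /= !add0r. Qed.
Fact addNq : left_inverse (Quat 0 0 0 0) oppq addq.
Proof. by move=> [????]; rewrite /addq /oppq /= !addNr. Qed.

HB.instance Definition _ :=
  GRing.isZmodule.Build (quat R) addqA addqC add0q addNq.

Definition mulq p q :=
  Quat (qre p * qre q - qi p * qi q - qj p * qj q - qk p * qk q)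
       (qre p * qi q + qi p * qre q + qj p * qk q - qk p * qj q)
       (qre p * qj q - qi p * qk q + qj p * qre q + qk p * qi q)
       (qre p * qk q + qi p * qj q - qj p * qi q + qk p * qre q).

Fact mulqA : associative mulq.
Proof. by move=> [????] [????] [????]; rewrite /mulq /=; congr Quat; ring. Qed.
Fact mul1q : left_id (Quat 1 0 0 0) mulq.
Proof. by move=> [????]; rewrite /mulq /=; congr Quat; ring. Qed.
Fact mulq1 : right_id (Quat 1 0 0 0) mulq.
Proof. by move=> [????]; rewrite /mulq /=; congr Quat; ring. Qed.
Fact mulqDl : left_distributive mulq +%R.
Proof.
by move=> [????] [????] [????]; rewrite /mulq /=; congr Quat => /=; ring.
Qed.
Fact mulqDr : right_distributive mulq +%R.
Proof.
by move=> [????] [????] [????]; rewrite /mulq /=; congr Quat => /=; ring.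
Qed.
Fact oneq_neq0 : Quat 1 0 0 0 != 0 :> quat R.
Proof. by apply/eqP => -[] /eqP; rewrite oner_eq0. Qed.

HB.instance Definition _ := GRing.Zmodule_isNzRing.Build (quat R)
  mulqA mul1q mulq1 mulqDl mulqDr oneq_neq0.

Definition conjq q : quat R := Quat (qre q) (- qi q) (- qj q) (- qk q).

Definition realq (a : R) : quat R := Quat a 0 0 0.

Lemma conjqB p q : conjq (p - q) = conjq p - conjq q.
Proof. by case: p q => [????] [????]; congr Quat => /=; ring. Qed.
HB.instance Definition _ := GRing.isZmodMorphism.Build _ _ conjq conjqB.

Lemma conjqM p q : conjq (p * q) = conjq q * conjq p.
Proof. by case: p q => [????] [????]; congr Quat => /=; ring. Qed.

Lemma conjqK : involutive conjq.
Proof. by case=> ????; rewrite /conjq /= !opprK. Qed.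

Lemma realqB a b : realq (a - b) = realq a - realq b.
Proof. by congr Quat => /=; ring. Qed.
HB.instance Definition _ := GRing.isZmodMorphism.Build _ _ realq realqB.

Lemma realq_monoid_morphism : monoid_morphism realq.
Proof. by split=> // a b; congr Quat => /=; ring. Qed.
HB.instance Definition _ :=
  GRing.isMonoidMorphism.Build _ _ realq realq_monoid_morphism.

Lemma conjq_real a : conjq (realq a) = realq a.
Proof. by rewrite /conjq /= oppr0. Qed.

Lemma realqC a q : realq a * q = q * realq a.
Proof. by case: q => ????; congr Quat => /=; ring. Qed.

End Quaternions.

Definition adjq (R : realType) (m n : nat) (A : 'M[quat R]_(m, n)) :
  'M[quat R]_(n, m) := map_mx (@conjq R) A^T.

Definition skew_hermitian (R : realType) (n : nat) : {pred 'M[quat R]_n} :=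
  fun A => adjq A == - A.

Section Adjoint.
Variable R : realType.

(* The library's [trmx_mul] needs commutative coefficients. *)
Lemma adjqM m n p (A : 'M[quat R]_(m, n)) (B : 'M[quat R]_(n, p)) :
  adjq (A *m B) = adjq B *m adjq A.
Proof.
apply/matrixP => i j; rewrite !mxE raddf_sum; apply: eq_bigr => k _.
by rewrite !mxE /= conjqM.
Qed.

Lemma adjqB m n (A B : 'M[quat R]_(m, n)) : adjq (A - B) = adjq A - adjq B.
Proof. by apply/matrixP => i j; rewrite !mxE raddfB. Qed.

Lemma adjqZ m n (a : R) (A : 'M[quat R]_(m, n)) :
  adjq (realq a *: A) = realq a *: adjq A.
Proof. by apply/matrixP => i j; rewrite !mxE conjqM conjq_real realqC. Qed.

Variable n : nat.

Fact skew_hermitian_zmod_closed : zmod_closed (@skew_hermitian R n).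
Proof.
split=> [|A B]; rewrite !unfold_in.
  by apply/eqP/matrixP => i j; rewrite !mxE raddf0 oppr0.
by move=> /eqP hA /eqP hB; rewrite adjqB hA hB opprD.
Qed.

HB.instance Definition _ :=
  GRing.isZmodClosed.Build _ (@skew_hermitian R n) skew_hermitian_zmod_closed.

Lemma skew_hermitianZ (a : R) (A : 'M[quat R]_n) :
  A \in @skew_hermitian R n -> realq a *: A \in @skew_hermitian R n.
Proof. by rewrite !unfold_in adjqZ => /eqP ->; rewrite scalerN. Qed.

Lemma skew_hermitian_comm (A B : 'M[quat R]_n) :
  A \in @skew_hermitian R n -> B \in @skew_hermitian R n ->
  A *m B - B *m A \in @skew_hermitian R n.
Proof.
rewrite !unfold_in adjqB !adjqM => /eqP -> /eqP ->.
by rewrite !mulNmx !mulmxN !opprK opprB.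
Qed.

End Adjoint.

Record sp (R : realType) (n : nat) :=
  Sp { sp_val :> 'M[quat R]_n; spP : sp_val \in @skew_hermitian R n }.

Section SpLie.
Variables (R : realType) (n : nat).
Local Notation sp := (sp R n).
Implicit Types x y z : sp.

HB.instance Definition _ := [isSub for @sp_val R n].
HB.instance Definition _ := [Choice of sp by <:].
HB.instance Definition _ := [SubChoice_isSubZmodule of sp by <:].

(* Matrices over [quat R] are a left [quat R]-module; sp(n) is only a real
   vector space, on which a real [a] acts through [realq a]. *)
Definition sp_scale (a : R) x : sp := Sp (skew_hermitianZ a (spP x)).

Fact sp_scaleA a b x : sp_scale a (sp_scale b x) = sp_scale (a * b) x.
Proof. by apply: val_inj; rewrite /= scalerA rmorphM. Qed.
Fact sp_scale1 : left_id 1 sp_scale.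
Proof. by move=> x; apply: val_inj; rewrite /= scale1r. Qed.
Fact sp_scaleDr : right_distributive sp_scale +%R.
Proof. by move=> a x y; apply: val_inj; rewrite /= scalerDr. Qed.
Fact sp_scaleDl x : {morph sp_scale^~ x : a b / a + b}.
Proof. by move=> a b; apply: val_inj; rewrite /= raddfD scalerDl. Qed.

HB.instance Definition _ := GRing.Zmodule_isLmodule.Build R sp
  sp_scaleA sp_scale1 sp_scaleDr sp_scaleDl.

Definition sp_bracket x y : sp := Sp (skew_hermitian_comm (spP x) (spP y)).

End SpLie.

Definition lie_automorphism (R : realType) (n : nat)
    (f : {linear sp R n -> sp R n}) : Prop :=
  bijective f /\
  forall x y, f (sp_bracket x y) = sp_bracket (f x) (f y).

Definition lie_involution (R : realType) (n : nat)
    (f : {linear sp R n -> sp R n}) : Prop :=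
  [/\ lie_automorphism f, forall x, f (f x) = x & exists x, f x <> x].

Definition four_sp1 (R : realType) : {pred sp R 4} :=
  fun x => is_diag_mx (sp_val x).

(* [four_sp1] is the image of the block-diagonal embedding of four copies of
   sp(1). *)
Lemma four_sp1P (R : realType) (x : sp R 4) :
  x \in @four_sp1 R <->
  exists y : 'I_4 -> sp R 1, sp_val x = diag_mx (\row_i sp_val (y i) 0 0).
Proof.
split=> [/is_diag_mxP dx | [y xE]]; last first.
  by rewrite unfold_in xE diag_mx_is_diag.
have y_sk i : const_mx (sp_val x i i) \in @skew_hermitian R 1.
  have /eqP/matrixP/(_ i i) := spP x; rewrite !mxE => xii.
  by apply/eqP/matrixP => j k; rewrite !mxE.
exists (fun i => Sp (y_sk i)); apply/matrixP => i j; rewrite !mxE /= ?mxE.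
by case: eqVneq => [<-|ij]; rewrite ?mulr1n // mulr0n dx.
Qed.

(* Main.v *)
From HB Require Import structures.
Require Import Defs.
From mathcomp Require Import all_boot all_order all_algebra.
From mathcomp Require Import reals.

(** Conjugation by a diagonal matrix with entries +1 and -1 is an involution of
    sp(n) whose fixed points are the matrices that vanish at every (i, j) where
    the i-th and j-th signs differ. For diag(1, 1, -1, -1) and
    diag(1, -1, 1, -1), which commute, any two indices in 0..3 are separated by
    at least one of the two sign patterns (the binary digits of the index), so
    the common fixed points are the diagonal matrices. *)

Set Implicit Arguments.
Unset Strict Implicit.
Unset Printing Implicit Defensive.

Import GRing.Theory Num.Theory.
Local Open Scope ring_scope.

(** This rests on characteristic zero in each real component; it makes a fixed entry vanish when
    conjugation flips its sign. *)
Lemma quat_oppr_eq (R : realType) (q : quat R) : - q = q -> q = 0.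
Proof.
case: q => a b c d [] /eqP + /eqP + /eqP + /eqP.
by rewrite !eqNr => /eqP -> /eqP -> /eqP -> /eqP ->.
Qed.

Section SignConjugation.
Variables (R : realType) (n : nat) (s : pred 'I_n).

Definition sign_mx : 'M[quat R]_n := diag_mx (\row_i (-1) ^+ s i).

Lemma sign_mxK : sign_mx *m sign_mx = 1%:M.
Proof.
rewrite mulmx_diag -diag_const_mx; congr diag_mx.
by apply/rowP => i; rewrite !mxE -signr_addb addbb.
Qed.

(** Signs are central even in the noncommutative [quat R], so the right-hand factor moves to the
    left and the two exponents add modulo 2. *)
Lemma sign_conjE (A : 'M[quat R]_n) i j :
  (sign_mx *m A *m sign_mx) i j = (-1) ^+ (s i (+) s j) * A i j.
Proof.
by rewrite mul_mx_diag mxE mul_diag_mx !mxE -mulrA commr_sign mulrA signr_addb.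
Qed.

(** The factor at (i, j) is a real sign symmetric in i and j, hence compatible with conjugate
    transposition. *)
Lemma sign_conj_skew (A : 'M[quat R]_n) :
  A \in @skew_hermitian R n -> sign_mx *m A *m sign_mx \in @skew_hermitian R n.
Proof.
move=> /eqP/matrixP hA; apply/eqP/matrixP => i j.
have hAij : conjq (A j i) = - A i j by have := hA i j; rewrite !mxE.
rewrite mxE mxE sign_conjE mxE sign_conjE.
by rewrite !mulr_sign addbC; case: ifP => _; rewrite ?raddfN /= hAij.
Qed.

Definition sign_conj (x : sp R n) : sp R n := Sp (sign_conj_skew (spP x)).

Fact sign_conj_linear : linear sign_conj.
Proof.
move=> a x y; apply/val_inj/matrixP => i j.
rewrite /= sign_conjE [RHS]mxE [X in _ = X + _]mxE !sign_conjE.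
rewrite !mxE mulrDr; congr (_ + _).
by rewrite mulrA -commr_sign -mulrA.
Qed.
HB.instance Definition _ :=
  GRing.isLinear.Build R (sp R n) (sp R n) _ sign_conj sign_conj_linear.

Lemma sign_conjK : involutive sign_conj.
Proof.
move=> x; apply: val_inj.
by rewrite /= !mulmxA sign_mxK mul1mx -mulmxA sign_mxK mulmx1.
Qed.

Lemma sign_conj_bracket x y :
  sign_conj (sp_bracket x y) = sp_bracket (sign_conj x) (sign_conj y).
Proof.
have conjM (A B : 'M[quat R]_n) :
    sign_mx *m A *m sign_mx *m (sign_mx *m B *m sign_mx)
    = sign_mx *m (A *m B) *m sign_mx.
  by rewrite !mulmxA -(mulmxA _ sign_mx sign_mx) sign_mxK mulmx1.
by apply: val_inj; rewrite /= !conjM mulmxBr mulmxBl.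
Qed.

Lemma sign_conj_fixedP (x : sp R n) :
  sign_conj x = x <-> (forall i j, s i != s j -> sp_val x i j = 0).
Proof.
split=> [fx i j | x0].
  rewrite negb_eqb => sij; apply: quat_oppr_eq.
  by rewrite -[in RHS]fx /= sign_conjE mulr_sign; case: (_ (+) _) sij.
apply/val_inj/matrixP => i j; rewrite /= sign_conjE mulr_sign -negb_eqb.
by case: ifP => // /x0 ->; rewrite oppr0.
Qed.

(** Provides an element that is moved when the signs at i and j differ, so that the order is exactly
    2. *)
Fact rotation_skew (i j : 'I_n) :
  delta_mx i j - delta_mx j i \in @skew_hermitian R n.
Proof.
have adj_delta k l : adjq (delta_mx k l : 'M[quat R]_n) = delta_mx l k.
  rewrite /adjq trmx_delta; apply/matrixP => u v; rewrite !mxE.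
  by case: (_ && _); rewrite ?raddf0 //; congr Quat; rewrite oppr0.
by rewrite unfold_in adjqB !adj_delta opprB.
Qed.

Lemma sign_conj_involution i j : s i != s j -> lie_involution sign_conj.
Proof.
move=> sij; split; [split | exact: sign_conjK |].
- by exists sign_conj; apply: sign_conjK.
- exact: sign_conj_bracket.
exists (Sp (rotation_skew i j)) => /sign_conj_fixedP/(_ i j sij)/eqP.
have ij : i == j = false by apply: contra_neqF sij => /eqP ->.
by rewrite /= !mxE !eqxx ij subr0 oner_eq0.
Qed.

End SignConjugation.

Lemma sign_conjC (R : realType) n (s t : pred 'I_n) (x : sp R n) :
  sign_conj s (sign_conj t x) = sign_conj t (sign_conj s x).
Proof.
apply/val_inj/matrixP => i j.
by rewrite /= !sign_conjE !mulrA -!signr_addb addbC.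
Qed.

Theorem theorem1p1 (R : realType) :
  exists theta tau : {linear sp R 4 -> sp R 4},
    [/\ lie_involution theta,
        lie_involution tau,
        (forall x : sp R 4, theta (tau x) = tau (theta x)) &
        (forall x : sp R 4,
           x \in @four_sp1 R <-> (theta x = x /\ tau x = x))].
Proof.
pose high (i : 'I_4) := (1 < i)%N; pose low (i : 'I_4) := odd i.
exists (sign_conj high), (sign_conj low); split.
(* The indices 0 and 3 differ in both binary digits, so this one pair serves both involutions. *)
- exact: (@sign_conj_involution _ _ _ ord0 ord_max).
- exact: (@sign_conj_involution _ _ _ ord0 ord_max).
- exact: sign_conjC.
move=> x; split=> [/is_diag_mxP dx |
                    [/sign_conj_fixedP hx /sign_conj_fixedP lx]].
  by split; apply/sign_conj_fixedP => i j sij; apply: dx;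
    apply: contra_neq sij => /val_inj ->.
apply/is_diag_mxP => i j ij.
(* If the high digits differ, [hx] kills the entry; otherwise distinct indices differ in the low
   digit, as checked on all pairs. *)
have [hij | /hx //] := eqVneq (high i) (high j).
apply: lx; move: i j ij hij.
by do 2!case=> [[|[|[|[|?]]]] ?] //.
Qed.
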